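(* Let $g$ be a positive integer and $\mu=2g$. Let $(r_0,r_1,\dots,r_h)$, $h\ge1$, be a $\delta$-sequence such that the numerical semigroup $\Gamma=\langle r_0,\dots,r_h\rangle$ has conductor $\mu$, and let $d_h=\gcd(r_0,\dots,r_{h-1})$. If $\Gamma\neq\langle 3,2\rangle$, then $$2\le r_h\le \mu-2\qquad\text{and}\qquad 2\le d_h\le \frac{\mu}{r_h-1}+1 .$$
   Context: The conductor of a numerical semigroup $\Gamma$ is the least integer $c$ such that all integers $\ge c$ belong to $\Gamma$ (the Frobenius number plus one). A sequence $(a_0,\dots,a_s)$ of coprime nonnegative integers is a $\delta$-sequence if, with $D_1=a_0$ and $D_k=\gcd(D_{k-1},a_{k-1})$ for $2\le k\le s+1$: (1) $\langle a_0,\dots,a_s\rangle$ is free for this arrangement, i.e. for each $1\le k\le s$, $\frac{D_k}{D_{k+1}}a_k\in\langle a_0,\dots,a_{k-1}\rangle$ and $\frac{D_k}{D_{k+1}}$ is the least positive integer with this property; (2) $a_kD_k>a_{k+1}D_{k+1}$ for $1\le k\le s-1$; (3) $a_0>a_1>D_2>D_3>\dots>D_{s+1}=1$. *)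

(* Defs.v *)
From mathcomp Require Import all_boot all_order all_algebra.
From mathcomp Require Import classical_sets.

Set Implicit Arguments.
Unset Strict Implicit.
Unset Printing Implicit Defensive.

Local Open Scope nat_scope.
Local Open Scope classical_set_scope.

(* The semigroup <a_0, ..., a_s> (with 0) of nonnegative integer
   combinations of the entries of a. *)
Definition semigroup_gen (a : seq nat) : set nat :=
  [set x | exists c : nat -> nat, x = \sum_(i < size a) c i * nth 0 a i].

(* For G a set of nonnegative integers, the least such integer is nonnegative,
   so nothing is lost by letting c range over nat. *)
Definition is_conductor (G : set nat) (c : nat) : Prop :=
  (forall n, c <= n -> G n) /\
  (forall c', (forall n, c' <= n -> G n) -> c <= c').

(* D_1 = gcd(0, a_0) = a_0 and D_k = gcd(D_(k-1), a_(k-1)) for k >= 2. *)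
Fixpoint deltaD (a : seq nat) (k : nat) : nat :=
  if k is k'.+1 then gcdn (deltaD a k') (nth 0 a k') else 0.

Definition free_arrangement (a : seq nat) : Prop :=
  forall k, 1 <= k < size a ->
    let n := deltaD a k %/ deltaD a k.+1 in
    [/\ 0 < n,
        semigroup_gen (take k a) (n * nth 0 a k) &
        forall m, 0 < m -> semigroup_gen (take k a) (m * nth 0 a k) -> n <= m].

(* With a = (a_0, ..., a_s), size a = s + 1; the last clause D_(s+1) = 1 is
   also the coprimality of the entries. *)
Definition delta_sequence (a : seq nat) : Prop :=
  [/\ free_arrangement a,
      forall k, 1 <= k -> k.+1 < size a ->
        nth 0 a k.+1 * deltaD a k.+1 < nth 0 a k * deltaD a k &
      [/\ nth 0 a 1 < nth 0 a 0,
          deltaD a 2 < nth 0 a 1,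
          forall k, 2 <= k < size a -> deltaD a k.+1 < deltaD a k &
          deltaD a (size a) = 1]].

(* Main.v *)
Require Import Defs.
From mathcomp Require Import all_boot all_order all_algebra.
From mathcomp Require Import classical_sets.
From mathcomp Require Import zify.

(** Write d = d_h and r = r_h. All elements of <r_0, ..., r_(h-1)> are multiples
    of d, and gcd(d, r) = 1, so (d - 1)(r - 1) - 1, the Frobenius number of
    <d, r>, is a gap of Gamma; this bounds d_h, and for h = 1 also r_h.
    When h >= 2, d itself is not in <r_0, ..., r_(h-1)>, which makes
    (d - 1) r + d a gap as well and gives r + 2 <= mu. *)

Set Implicit Arguments.
Unset Strict Implicit.
Unset Printing Implicit Defensive.

Import GRing.Theory Num.Theory.

Lemma deltaD_big_gcdn (a : seq nat) k :
  deltaD a k = \big[gcdn/0]_(i < k) nth 0 a i.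
Proof. by elim: k => [|k IHk]; rewrite ?big_ord0 // big_ord_recr /= IHk. Qed.

Lemma deltaD_dvd_nth (a : seq nat) k i : i < k -> deltaD a k %| nth 0 a i.
Proof.
by move=> lt_ik; rewrite deltaD_big_gcdn (biggcdn_inf (Ordinal lt_ik)).
Qed.

Lemma semigroup_gen_dvd (a : seq nat) k x :
  semigroup_gen (take k a) x -> deltaD a k %| x.
Proof.
case=> c ->; apply: dvdn_sum => i _; apply: dvdn_mull.
have lt_ik : i < k by apply: leq_trans (ltn_ord i) _; rewrite size_take_min geq_minl.
by rewrite nth_take ?deltaD_dvd_nth.
Qed.

Lemma semigroup_gen_takeS (a : seq nat) k x : k < size a ->
  semigroup_gen (take k.+1 a) x ->
  exists X c, semigroup_gen (take k a) X /\ x = X + c * nth 0 a k.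
Proof.
move=> lt_ka [c ->]; exists (\sum_(i < k) c i * nth 0 a i), (c k); split.
  exists c; rewrite size_takel ?(ltnW lt_ka) //.
  by apply: eq_bigr => i _; rewrite nth_take.
rewrite size_takel // big_ord_recr /= nth_take //; congr (_ + _).
by apply: eq_bigr => i _; rewrite nth_take // ltnS ltnW.
Qed.

(** Induction on [k]. Suppose [D_(k+1) = X + c * a_k] with [X] generated by the earlier entries. If
    [c = 0], then [D_k] divides [X = D_(k+1)], which is positive and smaller than [D_k]. If [c > 0],
    then [a_k = D_(k+1)]: for [k = 1] this contradicts [D_2 < a_1], and otherwise freeness puts
    [D_k] itself among the combinations of the earlier entries, against the induction hypothesis. *)
Lemma deltaD_notin_semigroup_gen (a : seq nat) k :
  delta_sequence a -> 2 <= k <= size a ->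
  ~ semigroup_gen (take k a) (deltaD a k).
Proof.
case=> free_a _ [lt_a10 lt_D2 decD _].
elim: k => // k IHk /andP[k_gt0 le_ka] /(semigroup_gen_takeS le_ka) [X [c [gX def_D]]].
have lt_D : 0 < deltaD a k.+1 < deltaD a k.
  have [k1|k1] := eqVneq k 1; last first.
    have k2 : 2 <= k < size a by lia.
    rewrite decD // andbT; have [] := free_a k; first by lia.
    (* Division by 0 yields 0, so the positive quotient excludes [D_(k+1) = 0]. *)
    by case: (deltaD a k.+1) => [|//]; rewrite divn0.
  rewrite k1 in lt_D2 *.
  have D1 : deltaD a 1 = nth 0 a 0 by rewrite /= gcd0n.
  rewrite D1; apply/andP; split; last by lia.
  have := dvdn_leq _ (@deltaD_dvd_nth a 2 0 isT).
  case: (posnP (deltaD a 2)) (@deltaD_dvd_nth a 2 0 isT) => // ->.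
  by rewrite dvd0n => /eqP; lia.
case/andP: lt_D => D_gt0 lt_D.
have [c0|c_gt0] := posnP c.
  have eqX : deltaD a k.+1 = X by rewrite def_D c0 addn0.
  have := dvdn_leq _ (semigroup_gen_dvd gX); rewrite -eqX => /(_ D_gt0).
  by rewrite leqNgt lt_D.
have a_gt0 : 0 < nth 0 a k.
  by rewrite lt0n; apply: contraTneq lt_D => /= ->; rewrite gcdn0 ltnn.
have aD : nth 0 a k = deltaD a k.+1.
  apply/eqP; rewrite eqn_leq (dvdn_leq a_gt0) ?deltaD_dvd_nth // andbT.
  by rewrite def_D -{1}[nth 0 a k]mul1n -[X in X <= _]add0n leq_add ?leq_mul.
have [k1|k1] := eqVneq k 1; first by move: lt_D2 aD; rewrite k1 => /[swap] ->; rewrite ltnn.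
have [|_ + _] := free_a k; first by lia.
rewrite aD divnK; last by rewrite /= dvdn_gcdl.
by apply: IHk; lia.
Qed.

(** Adding [r] to both sides makes the left side [r * d + Y], so [d] divides [c.+1 * r]. For the
    gaps below this forces [c >= d - 1]. *)
Lemma dvdn_succ_coprime_coef d r X Y c : 0 < d -> coprime d r ->
  d %| X -> d %| Y -> r * d.-1 + Y = X + c * r -> d %| c.+1.
Proof.
move=> d_gt0 co_dr dX dY eqXY.
rewrite -(Gauss_dvdl _ co_dr) mulSn -(dvdn_addr _ dX).
have -> : X + (r + c * r) = r * d + Y.
  by rewrite addnCA -eqXY addnA -mulnS prednK.
by rewrite dvdn_addr ?dvdn_mull.
Qed.

Theorem mainTheorem3 (g mu h : nat) (r : h.+1.-tuple nat) :
  (0 < g)%N ->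
  mu = (2 * g)%N ->
  (1 <= h)%N ->
  delta_sequence r ->
  is_conductor (semigroup_gen r) mu ->
  semigroup_gen r <> semigroup_gen [:: 3; 2] ->
  let rh := nth 0%N r h in
  let dh := \big[gcdn/0%N]_(i < h) nth 0%N r i in
  (2 <= rh <= mu - 2)%N /\
  ((2 <= dh)%N /\ (dh%:R <= mu%:R / (rh%:R - 1) + 1 :> rat)%R).
Proof.
case: r => r /= /eqP sz_r g_gt0 def_mu h_gt0 del_r [gen_mu _] neq32.
set rh := nth 0 r h; set dh := \big[_/_]_(i < h) _.
have gap_lt x : ~ semigroup_gen r x -> x < mu.
  by move=> gap_x; rewrite ltnNge; apply/negP => /gen_mu.
have gen_r x : semigroup_gen r x ->
    exists X c, semigroup_gen (take h r) X /\ x = X + c * rh.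
  move=> gx; apply: semigroup_gen_takeS; rewrite ?sz_r //.
  by rewrite take_oversize // sz_r.
have def_dh : deltaD r h = dh by rewrite deltaD_big_gcdn.
have dvd_gen X : semigroup_gen (take h r) X -> dh %| X.
  by rewrite -def_dh; apply: semigroup_gen_dvd.
have [free_r _ [lt_r10 lt_D2 decD D1]] := del_r; rewrite sz_r in decD D1.
have co_dr : coprime dh rh by rewrite /coprime -def_dh -[X in _ == X]D1.
have r0_h1 : h = 1 -> dh = nth 0 r 0.
  by move=> h1; rewrite -def_dh h1 /= gcd0n.
have dh_gt1 : 1 < dh.
  have [h1|h1] := eqVneq h 1.
    by rewrite r0_h1 //; rewrite h1 in D1; rewrite D1 in lt_D2; lia.
  by rewrite -def_dh -D1; apply: decD; lia.
have rh_gt1 : 1 < rh.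
  have [h1|h1] := eqVneq h 1.
    by rewrite h1 in D1; rewrite D1 in lt_D2; rewrite /rh h1.
  (* [rh = 0] would make the gcd equal to [dh > 1]; [rh = 1] would, by freeness, put [dh] in the
     semigroup of the earlier entries. *)
  case def_r: rh co_dr => [|[|//]]; first by rewrite /coprime gcdn0; lia.
  have [|_ + _ _] := free_r h; first by rewrite sz_r; lia.
  rewrite D1 divn1 -/rh def_r muln1 => /deltaD_notin_semigroup_gen.
  by case; rewrite ?sz_r //; lia.
have frob_bound : (dh - 1) * (rh - 1) <= mu.
  suff : dh.-1 * rh.-1 - 1 < mu by lia.
  apply: gap_lt => /gen_r[X [c [/dvd_gen dX eqX]]].
  (* Positivity makes the truncated [- 1] a genuine subtraction. *)
  have prod_gt0 : 0 < dh.-1 * rh.-1 by rewrite muln_gt0; lia.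
  have rhE : rh * dh.-1 = dh.-1 * rh.-1 + dh.-1.
    by rewrite mulnC -mulnSr prednK // ltnW.
  have le_dc : dh.-1 <= c.
    suff /dvdn_leq : dh %| c.+1 by lia.
    (* The supposed gap plus [dh] is exactly [rh * dh.-1], whence [X + dh] and [Y = 0]. *)
    apply: (@dvdn_succ_coprime_coef dh rh (X + dh) 0); rewrite ?dvdn_addr ?dX //; lia.
  by have := leq_mul le_dc (leqnn rh); lia.
have rh_le : rh <= mu - 2.
  have [h1|h1] := eqVneq h 1; last first.
    (* Since [dh >= 2], the left side is at least [rh + 2]. *)
    suff : rh * dh.-1 + dh < mu.
      by nia.
    apply: gap_lt => /gen_r[X [c [gX eqX]]].
    have /dvdnP[k def_c] : dh %| c.+1.
      by apply: dvdn_succ_coprime_coef eqX; rewrite ?(dvd_gen X) //; lia.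
    (* [k = 1] leaves [X = dh], which is not generated; [k >= 2] makes [c * rh] too large. *)
    have [k_eq|k_gt] : k = 1 \/ 2 <= k by case: k def_c => [|[|]]; lia.
      have eqXd : X = dh.
        by move: eqX; rewrite (_ : c = dh.-1); [lia | move: def_c; rewrite k_eq; lia].
      apply: (@deltaD_notin_semigroup_gen r h) => //; first by rewrite sz_r; lia.
      by rewrite def_dh -eqXd.
    have le_dc : dh + dh.-1 <= c by have := leq_mul k_gt (leqnn dh); lia.
    have := leq_mul le_dc (leqnn rh); have := leq_mul (leqnn dh) rh_gt1.
    by rewrite mulnDl; lia.
  have lt_rd : rh < dh by rewrite r0_h1 // /rh h1.
  (* For [rh >= 3], [frob_bound] and [rh <= dh - 1] give [mu >= 2 * rh]. *)
  have [rh2|rh_neq2] := eqVneq rh 2; last by nia.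
  (* Then [dh >= 4], so [mu >= 3], and [mu = 2 * g] is even, so [mu >= 4]. *)
  suff dh_neq3 : dh != 3 by rewrite rh2 in frob_bound *; lia.
  apply/eqP => dh3; apply: neq32; congr semigroup_gen.
  apply: (@eq_from_nth _ 0); first by rewrite sz_r h1.
  rewrite sz_r h1 => -[|[|//]] _ /=; first by rewrite -dh3 r0_h1.
  by rewrite -rh2 /rh h1.
do !split=> //; first by rewrite rh_gt1.
have natrB1 n : 1 < n -> (n%:R - 1 = (n - 1)%:R :> rat)%R.
  by move=> /ltnW n_gt0; rewrite natrB.
rewrite -lerBlDr ler_pdivlMr; last by rewrite subr_gt0 ltr1n.
by rewrite !natrB1 // -natrM ler_nat.
Qed.
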